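(* Let $a_0,a_1,a_2,b_0,b_1$ be arbitrary complex parameters, and suppose that the $6$ coefficients $c_0,\dots,c_5$ of the monic sextic polynomial $P_6(x)=x^6+\sum_{n=0}^{5}c_n x^n$ are given by $$c_5=2a_2,\qquad c_4=2a_1+a_2^2,\qquad c_3=2a_0+2a_1a_2+b_1,$$ $$c_2=a_1^2+(2a_0+b_1)a_2,\qquad c_1=(2a_0+b_1)a_1,\qquad c_0=a_0^2+a_0b_1+b_0 .$$ Then the $6$ roots $z_{\lambda\mu}$ ($\lambda=1,2$; $\mu=1,2,3$) of $P_6$ are given as follows: let $y_1,y_2$ be the $2$ roots of the quadratic equation $$y^2+b_1y+b_0=0,$$ and, for each $\lambda=1,2$, let $z_{\lambda 1},z_{\lambda 2},z_{\lambda 3}$ be the $3$ roots of the cubic equation in $z$ $$z^3+a_2z^2+a_1z+a_0=y_\lambda .$$ Then $z_{\lambda\mu}$, $\lambda=1,2$, $\mu=1,2,3$, are the $6$ roots of $P_6$.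
   Context: All coefficients, parameters and roots are complex numbers, and roots of polynomials are listed with multiplicity; thus the assertion that the numbers $z_{\lambda\mu}$ are the $6$ roots of $P_6$ means $P_6(x)=\prod_{\lambda=1}^{2}\prod_{\mu=1}^{3}(x-z_{\lambda\mu})$. *)

(* Defs.v *)
From mathcomp Require Import all_boot all_order all_algebra.
From mathcomp Require Import complex reals.

Set Implicit Arguments.
Unset Strict Implicit.
Unset Printing Implicit Defensive.

Import GRing.Theory.
Local Open Scope ring_scope.

(* For a monic polynomial p of degree #|I|: the family (r i) lists the roots
   of p, repeated according to multiplicity. *)
Definition roots_listed_by (F : fieldType) (I : finType)
    (p : {poly F}) (r : I -> F) : Prop :=
  p = \prod_(i : I) ('X - (r i)%:P).

(* Main.v *)
Require Import Defs.
From mathcomp Require Import all_boot all_order all_algebra.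
From mathcomp Require Import complex reals ring.

Set Implicit Arguments.
Unset Strict Implicit.
Unset Printing Implicit Defensive.

Import GRing.Theory.
Local Open Scope ring_scope.

(** [P_6] is the composition of the quadratic with the cubic
    [Q = x^3 + a2 x^2 + a1 x + a0]; composing the factorization
    [(y - y_1) (y - y_2)] with [Q] gives [P_6 = (Q - y_1) (Q - y_2)]. *)

(** The prescribed [c_n] are exactly the coefficients of [Q^2 + b1 Q + b0]. Working with
    factorizations rather than root sets keeps track of multiplicities, even when the [y_l] or the
    [z_{l,m}] coincide. *)

Lemma comp_poly_prod_XsubC (R : comNzRingType) (I : finType) (r : I -> R)
    (q : {poly R}) :
  (\prod_(i : I) ('X - (r i)%:P)) \Po q = \prod_(i : I) (q - (r i)%:P).
Proof.
rewrite rmorph_prod /=; apply: eq_bigr => i _.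
by rewrite comp_polyB comp_polyX comp_polyC.
Qed.

Theorem mainTheorem1 (R : realType)
    (a0 a1 a2 b0 b1 c0 c1 c2 c3 c4 c5 : R[i])
    (hc5 : c5 = 2 * a2)
    (hc4 : c4 = 2 * a1 + a2 ^+ 2)
    (hc3 : c3 = 2 * a0 + 2 * a1 * a2 + b1)
    (hc2 : c2 = a1 ^+ 2 + (2 * a0 + b1) * a2)
    (hc1 : c1 = (2 * a0 + b1) * a1)
    (hc0 : c0 = a0 ^+ 2 + a0 * b1 + b0)
    (y : 'I_2 -> R[i])
    (hy : roots_listed_by ('X^2 + b1 *: 'X + b0%:P) y)
    (z : 'I_2 -> 'I_3 -> R[i])
    (hz : forall l : 'I_2,
        roots_listed_by
          ('X^3 + a2 *: 'X^2 + a1 *: 'X + a0%:P - (y l)%:P) (z l)) :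
  'X^6 + (c5 *: 'X^5 + c4 *: 'X^4 + c3 *: 'X^3 + c2 *: 'X^2 + c1 *: 'X + c0%:P)
    = \prod_(l < 2) \prod_(m < 3) ('X - (z l m)%:P).
Proof.
set Q := 'X^3 + a2 *: 'X^2 + a1 *: 'X + a0%:P.
have -> : \prod_(l < 2) \prod_(m < 3) ('X - (z l m)%:P)
    = \prod_(l < 2) (Q - (y l)%:P).
  by apply: eq_bigr => l _; rewrite (hz l).
(* Read backwards, the product over [l] is the quadratic in [y] evaluated at [Q]. *)
rewrite -comp_poly_prod_XsubC -hy !comp_polyD comp_polyZ comp_Xn_poly comp_polyX.
rewrite comp_polyC /Q hc5 hc4 hc3 hc2 hc1 hc0 -!mul_polyC.
(* Splitting the constants [c_n] into [a_i%:P] and [b_j%:P] leaves a commutative ring identity in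
   these and ['X]. *)
by rewrite !(polyCD, polyCM, polyC_exp); ring.
Qed.
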